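(* Every nonempty closed monovex subset of $\mathbb{R}^n$ is contractible.
   Context: A set $A \subseteq \mathbb{R}^n$ is called monovex if for every $x,y \in A$ there is a continuous path $\gamma:[0,1]\to A$ with $\gamma(0)=x$, $\gamma(1)=y$, such that each coordinate function $\gamma_i:[0,1]\to\mathbb{R}$, $i=1,\dots,n$, is monotone (nondecreasing or nonincreasing). Coordinates are with respect to the standard basis of $\mathbb{R}^n$. *)

(* Defs.v *)
From HB Require Import structures.
From mathcomp Require Import all_boot all_order all_algebra.
From mathcomp Require Import all_classical all_reals all_analysis.
Set Implicit Arguments. Unset Strict Implicit. Unset Printing Implicit Defensive.
Import Order.TTheory GRing.Theory Num.Theory.
Import numFieldNormedType.Exports.
Local Open Scope classical_set_scope.
Local Open Scope ring_scope.

Definition unit_interval (R : realType) : set R := `[0, 1]%classic.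
Arguments unit_interval R : clear implicits.

Definition monotone_on01 (R : realType) (f : R -> R) : Prop :=
  {in unit_interval R &, {homo f : s t / s <= t}} \/
  {in unit_interval R &, {homo f : s t / s <= t >-> t <= s}}.

Definition monovex (R : realType) (n : nat) (A : set 'rV[R]_n) : Prop :=
  forall x y, A x -> A y ->
  exists gamma : R -> 'rV[R]_n,
    [/\ {within unit_interval R, continuous gamma},
        (forall t, unit_interval R t -> A (gamma t)),
        gamma 0 = x, gamma 1 = y &
        forall i : 'I_n, monotone_on01 (fun t => gamma t ord0 i)].

Definition contractible (R : realType) (n : nat) (A : set 'rV[R]_n) : Prop :=
  exists (x0 : 'rV[R]_n) (H : R * 'rV[R]_n -> 'rV[R]_n),
    [/\ A x0,
        {within [set p | unit_interval R p.1 /\ A p.2], continuous H},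
        (forall t x, unit_interval R t -> A x -> A (H (t, x))),
        (forall x, A x -> H (0, x) = x) &
        (forall x, A x -> H (1, x) = x0)].

(* Main.v *)
(** Write AE for "absolute extensor": continuous maps into the set, defined on a
    closed part of a normal space X, extend to X.  A bounded closed monovex set A
    is an AE, by induction on the number of coordinates that are not constant
    on A.  Given f : D -> A, cut A by a hyperplane [z_i = c] that has points of A
    on both sides.  Extend [f_i] by Tietze to g : X -> R; the section
    [A `&` [z_i = c]] is monovex, hence an AE, so f extends to [g = c] with
    values in the section, and it remains to extend it separately over [g <= c]
    and [g >= c], with values in the two halves of A, which are monovex again.
    Cutting successively along all hyperplanes with i < n and c rational, each
    point x of X lands in nested pieces of A that shrink to a single point, the
    value of the extension at x.  It does not depend on the side chosen for x,
    because the value is already fixed on the overlaps, and it is continuous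
    because the finitely many regions at each depth are closed and cover X.
    In particular A, bounded or not, is a retract of its ambient space (extend
    over larger and larger balls), and a retract of a convex set is
    contractible. *)
Require Import Defs.
From HB Require Import structures.
From mathcomp Require Import all_boot all_order all_algebra.
From mathcomp Require Import all_classical all_reals all_analysis.
Set Implicit Arguments. Unset Strict Implicit. Unset Printing Implicit Defensive.
Import Order.TTheory GRing.Theory Num.Theory.
Import numFieldNormedType.Exports.
Local Open Scope classical_set_scope.
Local Open Scope ring_scope.

(** * Monovex sets, boxes and sections *)

Definition box_convex (R : realType) (n : nat) (B : set 'rV[R]_n) : Prop :=
  forall x y z : 'rV[R]_n, B x -> B y ->
  (forall i, x ord0 i <= z ord0 i <= y ord0 i \/
             y ord0 i <= z ord0 i <= x ord0 i) -> B z.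

(** A coordinatewise monotone path stays in the box spanned by its endpoints, so the path provided
    by [A] never leaves [B]. *)
Lemma monovexI (R : realType) (n : nat) (A B : set 'rV[R]_n) :
  monovex A -> box_convex B -> monovex (A `&` B).
Proof.
move=> mA bB x y [Ax Bx] [Ay By].
have [g [cg Ag g0 g1 mg]] := mA _ _ Ax Ay.
exists g; split => // t It; split; first exact: Ag.
apply: (bB _ _ _ Bx By) => i.
have I0 : 0 \in unit_interval R by rewrite inE /unit_interval /= in_itv /= lexx ler01.
have I1 : 1 \in unit_interval R by rewrite inE /unit_interval /= in_itv /= lexx ler01.
have It' : t \in unit_interval R by rewrite inE.
move: It; rewrite /unit_interval /= in_itv /= => /andP[t0 t1].
by case: (mg i) => h; [left|right]; rewrite -g0 -g1; apply/andP; split; exact: h.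
Qed.

Lemma within_coord_continuous (R : realType) (n : nat) (X : topologicalType)
    (D : set X) (f : X -> 'rV[R]_n) (i : 'I_n) :
  {within D, continuous f} -> {within D, continuous (fun x => f x ord0 i)}.
Proof.
move=> cf x; apply: (@continuous_comp (subspace D) _ _ f (fun u : 'rV[R]_n => u ord0 i)).
  exact: cf.
exact: coord_continuous.
Qed.

Lemma monovex_section (R : realType) (n : nat) (A : set 'rV[R]_n) (i : 'I_n)
    (c : R) (x y : 'rV[R]_n) :
  monovex A -> A x -> A y -> x ord0 i <= c <= y ord0 i ->
  exists2 z, A z & z ord0 i = c.
Proof.
move=> mA Ax Ay /andP[xc cy].
have [g [cg Ag g0 g1 mg]] := mA _ _ Ax Ay.
have [||t It gt] := @IVT R (fun t => g t ord0 i) 0 1 c ler01.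
- exact: within_coord_continuous.
- by rewrite g0 g1 ge_min le_max xc cy orbT.
by exists (g t) => //; apply: Ag.
Qed.

(** * Extension problems and their cuts along coordinate hyperplanes *)

Definition absolute_extensor (R : realType) (n : nat) (X : topologicalType)
    (A : set 'rV[R]_n) : Prop :=
  forall (D : set X) (f : X -> 'rV[R]_n), closed D ->
  {within D, continuous f} -> (forall x, D x -> A (f x)) ->
  exists F : X -> 'rV[R]_n, [/\ continuous F, (forall x, D x -> F x = f x) &
    forall x, A (F x)].

Definition half_space (R : realType) (n : nat) (b : bool) (i : 'I_n) (c : R) :
  set 'rV[R]_n := [set x | if b then x ord0 i <= c else c <= x ord0 i].

Lemma box_convex_half_space (R : realType) (n : nat) b (i : 'I_n) (c : R) :
  box_convex (half_space b i c).
Proof.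
move=> x y z; rewrite /half_space /=; case: b => xc yc /(_ i) [] /andP[h1 h2].
- exact: le_trans yc.
- exact: le_trans xc.
- exact: le_trans h1.
- exact: le_trans h1.
Qed.

Lemma closed_half_line (R : realType) (X : topologicalType) (g : X -> R) b (c : R) :
  continuous g -> closed [set x | if b then g x <= c else c <= g x].
Proof.
move=> cg; case: b.
- by apply: (@closed_comp _ _ g [set t | t <= c]) => [x _|]; [exact: cg|exact: closed_le].
- by apply: (@closed_comp _ _ g [set t | c <= t]) => [x _|]; [exact: cg|exact: closed_ge].
Qed.

Lemma closed_half_space (R : realType) (n : nat) b (i : 'I_n) (c : R) :
  closed (half_space b i c).
Proof. by apply: closed_half_line => x; exact: coord_continuous. Qed.

Lemma within_eq_continuous (X Y : topologicalType) (D : set X) (f g : X -> Y) :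
  (forall x, D x -> f x = g x) ->
  {within D, continuous f} -> {within D, continuous g}.
Proof. by move=> fg; apply: subspace_eq_continuous => x; rewrite inE => /fg. Qed.

(** The task of extending [value], given on [settled], to a map from [region]
    to [target].  The part of [settled] outside [region] is harmless and is
    kept. *)
Record piece (R : realType) (n : nat) (X : topologicalType) := Piece {
  target : set 'rV[R]_n;
  region : set X;
  settled : set X;
  value : X -> 'rV[R]_n }.

(** Nonemptiness of the target is asked only over a nonempty region, because a cut may leave one
    side with no points of the target and an empty region. *)
Record valid_piece (R : realType) (n : nat) (X : topologicalType)
    (p : piece R n X) : Prop := ValidPiece {
  target_closed : closed (target p);
  target_monovex : monovex (target p);
  region_closed : closed (region p);
  settled_closed : closed (settled p);
  value_continuous : {within settled p, continuous (value p)};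
  value_target : forall x, settled p x -> target p (value p x);
  target_nonempty : region p !=set0 -> target p !=set0 }.

(** [cut_overlap] is what later makes the choice of side immaterial: where both regions meet, the
    value is already fixed, and it is the same on both sides. *)
Record is_cut (R : realType) (n : nat) (X : topologicalType) (i : 'I_n) (c : R)
    (p : piece R n X) (q : bool -> piece R n X) : Prop := Cut {
  cut_valid : forall b, valid_piece (q b);
  cut_target : forall b, target (q b) = target p `&` half_space b i c;
  cut_region : forall b, region (q b) `<=` region p;
  cut_cover : forall x, region p x -> exists b, region (q b) x;
  cut_settled : forall b x, region (q b) x -> settled p x ->
    settled (q b) x /\ value (q b) x = value p x;
  cut_overlap : forall x, region (q true) x -> region (q false) x ->
    [/\ settled (q true) x, settled (q false) x &
        value (q true) x = value (q false) x] }.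

Lemma closed_target_half_space (R : realType) (n : nat) (A : set 'rV[R]_n) b i c :
  closed A -> closed (A `&` half_space b i c).
Proof. by move=> cA; apply: closedI => //; exact: closed_half_space. Qed.

Lemma monovex_half_space (R : realType) (n : nat) (A : set 'rV[R]_n) b i c :
  monovex A -> monovex (A `&` half_space b i c).
Proof. by move=> mA; apply: monovexI => //; exact: box_convex_half_space. Qed.

(** The side [b] inherits the whole task and the other side gets an empty region, so there is no
    overlap to settle. *)
Lemma cut_trivial (R : realType) (n : nat) (X : topologicalType) (b : bool)
    (i : 'I_n) (c : R) (p : piece R n X) :
  valid_piece p -> target p `<=` half_space b i c ->
  exists q, is_cut i c p q.
Proof.
case: p => A M D f [/= cA mA cM cD cf fA ne] Ab.
pose q b' := Piece (A `&` half_space b' i c) (if b' == b then M else set0)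
  (if b' == b then D else set0) f.
exists q; split => //=.
- move=> b'; split => /=.
  + exact: closed_target_half_space.
  + exact: monovex_half_space.
  + by case: ifP => // _; exact: closed0.
  + by case: ifP => // _; exact: closed0.
  + by case: ifP => // _; exact: continuous_subspace0.
  + by case: eqP => // -> x Dx; split; [exact: fA|exact/Ab/fA].
  + case: eqP => [->|_ []//] /ne [x Ax].
    by exists x; split => //; exact: Ab.
- by move=> b1 z; case: ifP.
- by move=> x Mx; exists b; rewrite eqxx.
- by move=> b' x; case: ifP.
- by move=> x; case: b {Ab q} => /= [_ []|[]].
Qed.

Lemma cut_exists (R : realType) (n : nat) (X : topologicalType)
    (rho : R) (i : 'I_n) (c : R) (p : piece R n X) :
  normal_space X -> valid_piece p ->
  (forall x, target p x -> `|x ord0 i| <= rho) ->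
  (forall x y, target p x -> target p y -> x ord0 i < c -> c < y ord0 i ->
     absolute_extensor X (target p `&` [set z | z ord0 i = c])) ->
  exists q, is_cut i c p q.
Proof.
move=> nX vp bnd sec.
have [/(cut_trivial vp)//|/existsNP[y /not_implyP[py yc]]] :=
  pselect (target p `<=` half_space true i c).
have [/(cut_trivial vp)//|/existsNP[x /not_implyP[px xc]]] :=
  pselect (target p `<=` half_space false i c).
move: yc xc => /negP; rewrite -ltNge => yc /negP; rewrite -ltNge => xc.
have {}sec := sec _ _ px py xc yc.
case: p vp bnd px py sec => A M D f [/= cA mA cM cD cf fA ne] bnd Ax Ay sec.
(* Tietze's theorem wants a positive bound, and [rho] may be 0. *)
have rho0 : 0 < `|rho| + 1 by rewrite ltr_wpDl.
have [||g [fg cg _]] := continuous_bounded_extension nX cD rho0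
    (f := fun x => f x ord0 i).
- exact: within_coord_continuous.
- move=> z Dz; rewrite (le_trans (bnd _ (fA _ Dz)))//.
  by rewrite (le_trans (ler_norm _))// lerDl.
have {}fg : forall z, D z -> g z = f z ord0 i.
  by move=> z Dz; rewrite (fg z) // inE.
pose E := [set z | g z = c].
have cE : closed E.
  by apply: (@closed_comp _ _ g [set t | t = c]) => [z _|]; [exact: cg|exact: closed_eq].
have [||F [cF FD FA]] := sec (D `&` E) f (closedI cD cE).
- by apply: continuous_subspaceW cf => z [].
- by move=> z [Dz Ez]; split; [exact: fA|rewrite /= -fg].
(* [F] matters only on [E], where it is glued to [f]; the two agree on the intersection of [D] and
   [E]. *)
pose h z := if g z == c then F z else f z.
have hD z : D z -> f z = h z.
  by rewrite /h; case: eqP => // gz Dz; rewrite FD.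
have hE z : E z -> F z = h z by rewrite /h /E /= => ->; rewrite eqxx.
have ch : {within D `|` E, continuous h}.
  apply: withinU_continuous => //; first exact: within_eq_continuous cf.
  by apply: within_eq_continuous hE _; exact: continuous_subspaceT.
(* The i-th coordinate of [h] is [g], so cutting X by [g] matches cutting the target by the
   hyperplane. *)
have hA z : (D `|` E) z -> A (h z) /\ h z ord0 i = g z.
  case=> [Dz|Ez]; first by rewrite -hD // fg //; split => //; exact: fA.
  by rewrite -hE //; case: (FA z) => ? ->; rewrite Ez.
pose L b := [set z | if b then g z <= c else c <= g z].
have cL b : closed (L b) by exact: closed_half_line.
pose q b := Piece (A `&` half_space b i c) (M `&` L b) ((D `|` E) `&` L b) h.
exists q; split => //=.
- move=> b; split => /=.
  + exact: closed_target_half_space.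
  + exact: monovex_half_space.
  + exact: closedI.
  + by apply: closedI => //; exact: closedU.
  + by apply: continuous_subspaceW ch => z [].
  + by move=> z [/hA[Az hz]] Lz; split => //; case: b Lz; rewrite /L /half_space /= hz.
  + by case: b => _; [exists x|exists y]; split => //=; exact: ltW.
- move=> z Mz; have [gc|/ltW gc] := leP (g z) c; first by exists true.
  by exists false.
- by move=> b z [_ Lz] Dz; split; [split => //; left|rewrite -hD].
- move=> z [_ gc] [_ cg'].
  have Ez : E z by apply/eqP; rewrite eq_le gc.
  by split => //; split => //; right.
Qed.

(** * The infinite tree of cuts and its branches *)

(** Nodes are addressed by the list of sides chosen, the last choice first. *)
Definition cut_tree (R : realType) (n : nat) (X : topologicalType)
    (e : nat -> 'I_n * rat) (node : seq bool -> piece R n X) : Prop :=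
  forall s, is_cut (e (size s)).1 (ratr (e (size s)).2) (node s)
    (fun b => node (b :: s)).

Lemma cut_tree_exists (R : realType) (n : nat) (X : topologicalType)
    (e : nat -> 'I_n * rat) (P : piece R n X -> Prop) (root : piece R n X) :
  P root ->
  (forall i c p, P p -> exists2 q, is_cut i c p q & forall b, P (q b)) ->
  exists2 node, cut_tree e node & node [::] = root.
Proof.
move=> Proot step.
(* The hyperplane depends on the depth, so the choice ranges over pairs of a depth and a piece.
   Where [P] fails, [root] is a dummy value; [Pnode] shows that such pieces do not occur. *)
have /choice[next nextP] (mp : nat * piece R n X) : exists q, P mp.2 ->
    is_cut (e mp.1).1 (ratr (e mp.1).2) mp.2 q /\ forall b, P (q b).
  have [/step - /(_ (e mp.1).1 (ratr (e mp.1).2)) [q cq Pq]|nP] := pselect (P mp.2).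
    by exists q.
  by exists (fun=> root).
pose node := fix node s := if s is b :: s' then next (size s', node s') b else root.
have Pnode s : P (node s).
  by elim: s => //= b s /(nextP (size s, node s))[].
by exists node => // s; have [] := nextP (size s, node s) (Pnode s).
Qed.

Lemma settled_descend (R : realType) (n : nat) (X : topologicalType)
    (e : nat -> 'I_n * rat) (node : seq bool -> piece R n X) t s x :
  cut_tree e node -> region (node (t ++ s)) x -> settled (node s) x ->
  settled (node (t ++ s)) x /\ value (node (t ++ s)) x = value (node s) x.
Proof.
move=> tr; elim: t => [|b t ih] //= rx sx.
have [sx' vx'] := ih (cut_region (tr (t ++ s)) rx) sx.
by have [? ->] := cut_settled (tr (t ++ s)) rx sx'.
Qed.

(** Two distinct addresses of equal length part after their longest common suffix. The cut made
    there settles x with one value for both, and later cuts keep it. *)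
Lemma settled_overlap (R : realType) (n : nat) (X : topologicalType)
    (e : nat -> 'I_n * rat) (node : seq bool -> piece R n X) s s' x :
  cut_tree e node -> size s = size s' -> s <> s' ->
  region (node s) x -> region (node s') x ->
  [/\ settled (node s) x, settled (node s') x &
      value (node s) x = value (node s') x].
Proof.
move=> tr; elim: s s' => [|b s ih] [|b' s'] //= [ss] ne rx rx'.
have [ess|nss] := eqVneq s s'.
  subst s'; have := cut_overlap (tr s) (x := x).
  by move: b b' rx rx' ne => [] [] //= rx rx' _ /(_ _ _) -[].
have [sx sx' vx] := ih _ ss (elimN eqP nss) (cut_region (tr s) rx)
  (cut_region (tr s') rx').
have [? ->] := cut_settled (tr s) rx sx.
by have [? ->] := cut_settled (tr s') rx' sx'.
Qed.

Lemma region_branch (R : realType) (n : nat) (X : topologicalType)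
    (e : nat -> 'I_n * rat) (node : seq bool -> piece R n X) x :
  cut_tree e node -> region (node [::]) x ->
  exists br : nat -> seq bool,
    (forall m, size (br m) = m /\ region (node (br m)) x) /\
    (forall m, exists b, br m.+1 = b :: br m).
Proof.
move=> tr rx.
have /choice[next nextP] s : exists b, region (node s) x -> region (node (b :: s)) x.
  have [/(cut_cover (tr s))[b rb]|nr] := pselect (region (node s) x); last by exists true.
  by exists b.
exists (fix br m := if m is m'.+1 then next (br m') :: br m' else [::]).
split; last by move=> m; eexists.
by elim=> //= m [-> /nextP].
Qed.

Lemma branch_suffix (br : nat -> seq bool) k m :
  (forall m, exists b, br m.+1 = b :: br m) -> exists t, br (m + k)%N = t ++ br k.
Proof.
move=> h; elim: m => [|m [t ih]]; first by exists [::].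
by have [b] := h (m + k)%N; rewrite ih => ->; exists (b :: t).
Qed.

Lemma target_descend (R : realType) (n : nat) (X : topologicalType)
    (e : nat -> 'I_n * rat) (node : seq bool -> piece R n X) t s :
  cut_tree e node -> target (node (t ++ s)) `<=` target (node s).
Proof.
move=> tr; elim: t => //= b t ih; apply: subset_trans ih.
by rewrite (cut_target (tr _)) => ? [].
Qed.

(** Pick a point in each [K m]: a cluster point of this sequence lies in every [K m], which is
    closed and contains a tail. *)
Lemma nested_closed_compact (T : topologicalType) (A : set T) (K : nat -> set T) :
  compact A -> (forall m, closed (K m)) -> (forall m k, K (m + k)%N `<=` K k) ->
  (forall m, K m `<=` A) -> (forall m, K m !=set0) -> exists y, forall m, K m y.
Proof.
move=> cA clK decK KA /choice[u Ku].
have [|y [_ cy]] := cA (u @ \oo) _; first by exists 0%N => // m _; exact: (KA m _ (Ku m)).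
exists y => m; apply: (clK m) => B By; have [|z [Kz Bz]] := cy (K m) B _ By.
  by exists m => // k /= mk; apply: (decK (k - m)%N m); rewrite subnK.
by exists z.
Qed.

(** If y and z differed in coordinate i, some rational would lie strictly between. The corresponding
    cut occurs on the branch, which keeps one side only and so loses y or z. *)
Lemma branch_separates (R : realType) (n : nat) (X : topologicalType)
    (e : nat -> 'I_n * rat) (node : seq bool -> piece R n X) br (y z : 'rV[R]_n) :
  cut_tree e node -> (forall p, exists m, e m = p) ->
  (forall m, size (br m) = m) -> (forall m, exists b, br m.+1 = b :: br m) ->
  (forall m, target (node (br m)) y) -> (forall m, target (node (br m)) z) ->
  y = z.
Proof.
move=> tr esurj sz brS.
wlog suff le : y z / (forall m, target (node (br m)) y) ->
    (forall m, target (node (br m)) z) -> forall i, y ord0 i <= z ord0 i.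
  move=> Ty Tz; apply/rowP => i; apply/eqP.
  by rewrite eq_le (le y z)// (le z y).
move=> Ty Tz i; rewrite leNgt; apply/negP => /rat_in_itvoo[q].
rewrite in_itv /= => /andP[zq qy].
have [m em] := esurj (i, q).
have [b bS] := brS m; move: (Ty m.+1) (Tz m.+1).
rewrite bS (cut_target (tr _)) sz em /=.
case: b {bS} => -[_]; rewrite /half_space /= => h [_]; rewrite /half_space /= => h'.
  by move: h; rewrite leNgt qy.
by move: h'; rewrite leNgt zq.
Qed.

(** There are finitely many regions at depth m, all closed, so a neighbourhood of x misses those
    that do not contain x. *)
Lemma nbhs_region (R : realType) (n : nat) (X : topologicalType)
    (node : seq bool -> piece R n X) (m : nat) (x : X) :
  (forall s, closed (region (node s))) ->
  \forall x' \near x, forall s, size s = m -> region (node s) x' -> region (node s) x.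
Proof.
move=> cl; have : \forall x' \near x, forall s : m.-tuple bool,
    region (node s) x' -> region (node s) x.
  apply: filter_forall => s; have [rx|nrx] := pselect (region (node s) x).
    by apply: nearW.
  have : nbhs x (~` region (node s)).
    by apply: open_nbhs_nbhs; split => //; exact/closed_openC/cl.
  by apply: filterS => x' nx' rx'.
by apply: filterS => x' h s /eqP sm; exact: (h (Tuple sm)).
Qed.

(** A strict rational bound at x need only persist weakly nearby, since the rationals can be taken
    strictly inside the ball around each coordinate. *)
Lemma continuous_rational_bounds (R : realType) (n : nat) (X : topologicalType)
    (F : X -> 'rV[R]_n) :
  (forall x b i q, ~ half_space b i (ratr q) (F x) ->
     \forall x' \near x, half_space (~~ b) i (ratr q) (F x')) -> continuous F.
Proof.
move=> h x; apply/cvg_ballP => eps eps0.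
have : \forall x' \near x, forall i, ball (F x ord0 i) eps (F x' ord0 i).
  apply: filter_forall => i.
  have /rat_in_itvoo[p] : F x ord0 i - eps < F x ord0 i by rewrite ltrBlDr ltrDl.
  have /rat_in_itvoo[q] : F x ord0 i < F x ord0 i + eps by rewrite ltrDl.
  rewrite !in_itv /= => /andP[xq qe] /andP[ep px].
  have Hq := h x false i q; have Hp := h x true i p.
  have {}Hq : \forall x' \near x, F x' ord0 i <= ratr q.
    by apply: Hq; rewrite /half_space /=; apply/negP; rewrite -ltNge.
  have {}Hp : \forall x' \near x, ratr p <= F x' ord0 i.
    by apply: Hp; rewrite /half_space /=; apply/negP; rewrite -ltNge.
  near=> x'; rewrite /ball /= ltr_distlC.
  apply/andP; split.
    by apply: (lt_le_trans ep); near: x'.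
  by apply: le_lt_trans qe; near: x'.
by apply: filterS => x' hx'; split => // k i; rewrite [k]ord1; exact: hx'.
Unshelve. all: by end_near. Qed.

Lemma rV_norm_le (R : realType) (n : nat) (x : 'rV[R]_n) (rho : R) :
  0 <= rho -> `|x| <= rho <-> forall i, `|x ord0 i| <= rho.
Proof.
move=> rho0; rewrite {1}/Num.norm /= mx_normrE; split => [/bigmax_leP[_ h] i|h].
  exact: (h (ord0, i)).
by apply/bigmax_leP; split => // -[k i] _; rewrite [k]ord1; exact: h.
Qed.

(** * Bounded closed monovex sets are absolute extensors *)

(** The inductive step: an extensor is required only of subsets on which some coordinate that varies
    on [A] has become constant. *)
Lemma absolute_extensor_sections (R : realType) (n : nat) (X : topologicalType)
    (A : set 'rV[R]_n) (rho : R) (i0 : 'I_n) :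
  normal_space X -> closed A -> monovex A -> A !=set0 ->
  (forall x, A x -> `|x| <= rho) ->
  (forall i c B, closed B -> monovex B -> B !=set0 -> B `<=` A ->
     (forall x, B x -> x ord0 i = c) ->
     (exists x y, [/\ A x, A y & x ord0 i != y ord0 i]) ->
     absolute_extensor X B) ->
  absolute_extensor X A.
Proof.
move=> nX clA mA [a0 Aa0] bnd sec D f clD cf fA.
have rho0 : 0 <= rho by rewrite (le_trans _ (bnd _ Aa0)).
have cA : compact A.
  apply: bounded_closed_compact => //; exists rho; split; first exact: num_real.
  by move=> r rr x /bnd /le_trans; apply; exact: ltW.
(* The default [(i0, 0)] serves the numbers that encode no pair. *)
pose e m : 'I_n * rat := odflt (i0, 0) (unpickle m).
have esurj p : exists m, e m = p by exists (pickle p); rewrite /e pickleK.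
pose root := Piece A setT D f.
pose P (p : piece R n X) := valid_piece p /\ target p `<=` A.
have [||node tr nroot] := @cut_tree_exists R n X e P root.
- by split => //; split => //; exists a0.
- move=> i c p [vp pA].
  have [|x y px py xc cy|q cq] := @cut_exists R n X rho i c p nX vp.
  + by move=> x /pA/bnd/(rV_norm_le _ rho0).
  + apply: (sec i c).
    * apply: closedI; first exact: target_closed vp.
      by apply: (@closed_comp _ _ (fun z : 'rV[R]_n => z ord0 i) [set t | t = c]) => [z _|];
        [exact: coord_continuous|exact: closed_eq].
    * apply: monovexI; first exact: target_monovex vp.
      move=> u v w /= uc vc /(_ i); rewrite uc vc.
      by case=> h; apply/eqP; rewrite eq_le andbC.
    * have [|z pz zc] := monovex_section (i := i) (c := c) (target_monovex vp) px py.
        by rewrite !ltW.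
      by exists z.
    * by move=> z [/pA].
    * by move=> z [].
    * exists x, y; split; [exact: pA|exact: pA|].
      by rewrite lt_eqF // (lt_trans xc).
  + by exists q => // b; split; [exact: cut_valid cq b|rewrite (cut_target cq) => z [/pA]].
have vnode s : valid_piece (node s).
  case: s => [|b s]; last exact: cut_valid (tr s) b.
  by rewrite nroot; split => //; exists a0.
have nodeA s : target (node s) `<=` A.
  by have := target_descend (t := s) (s := [::]) tr; rewrite cats0 nroot.
have rroot x : region (node [::]) x by rewrite nroot.
have /choice[br brP] x := region_branch tr (rroot x).
have brr x m : region (node (br x m)) x by have [/(_ m)[]] := brP x.
have brs x m : size (br x m) = m by have [/(_ m)[]] := brP x.
have brS x : forall m, exists b, br x m.+1 = b :: br x m by have [] := brP x.
have dec x m k : target (node (br x (m + k)%N)) `<=` target (node (br x k)).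
  by have [t ->] := branch_suffix k m (brS x); exact: target_descend.
have /choice[F FP] x : exists y, forall m, target (node (br x m)) y.
  apply: (nested_closed_compact cA).
  - by move=> m; exact: target_closed.
  - exact: dec.
  - by move=> m; exact: nodeA.
  - by move=> m; apply: (target_nonempty (vnode _)); exists x; exact: brr.
(* A settled value stays settled down the branch, so it lies in every target there, just as [F x]
   does. *)
have FE x m : settled (node (br x m)) x -> F x = value (node (br x m)) x.
  move=> sx; apply: (branch_separates tr esurj (brs x) (brS x) (FP x)) => k.
  apply: (dec x m k); rewrite addnC.
  have [t bt] := branch_suffix m k (brS x).
  have := brr x (k + m)%N; rewrite bt => /(settled_descend tr)/(_ sx)[s' <-].
  exact: value_target s'.
(* This covers every node over x, not only those on the chosen branch; continuity needs it. *)
have FT s x : region (node s) x -> target (node s) (F x).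
  move=> rs; have [->|/eqP ne] := eqVneq s (br x (size s)); first exact: FP.
  have [sx sx' vx] := settled_overlap tr (esym (brs x (size s))) ne rs (brr _ _).
  by rewrite (FE _ _ sx') -vx; exact: value_target sx.
exists F; split.
- apply: continuous_rational_bounds => x b i q nq.
  have [m em] := esurj (i, q).
  (* Cut number m produces the nodes of depth [m.+1]. For x' near x, the node of x' at that depth
     also lies over x, so [F x] and [F x'] are on the same closed side, which cannot be [b]. *)
  have := nbhs_region m.+1 x (fun s => region_closed (vnode s)).
  apply: filterS => x' /(_ (br x' m.+1) (brs _ _) (brr _ _)).
  have [b' bS] := brS x' m; move: (FP x' m.+1); rewrite bS => Fx' /FT Fx.
  move: Fx' Fx; rewrite !(cut_target (tr _)) brs em /= => -[_ h'] [_ h].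
  by move: b b' nq h h' {bS} => [] [].
- move=> x Dx; have b0 : br x 0%N = [::] by exact/size0nil/brs.
  by have := FE x 0%N; rewrite b0 nroot; exact.
- by move=> x; have := FP x 0%N => /nodeA.
Qed.

Lemma absolute_extensor_subsingleton (R : realType) (n : nat)
    (X : topologicalType) (A : set 'rV[R]_n) :
  A !=set0 ->
  (forall x y i, A x -> A y -> x ord0 i != y ord0 i -> False) ->
  absolute_extensor X A.
Proof.
move=> [a Aa] sub D f clD cf fA; exists (fun=> a); split => // [x|x Dx].
  exact: cvg_cst.
by apply/rowP => i; apply/eqP/negPn/negP => /(sub _ _ _ Aa (fA _ Dx)).
Qed.

Theorem absolute_extensor_compact_monovex (R : realType) (n : nat)
    (X : topologicalType) (A : set 'rV[R]_n) (rho : R) :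
  normal_space X -> closed A -> monovex A -> A !=set0 ->
  (forall x, A x -> `|x| <= rho) -> absolute_extensor X A.
Proof.
move=> nX.
(* [S] may be any set containing the coordinates that vary on [B]; passing to a section removes one
   element from it. *)
suff main (d : nat) (S : {set 'I_n}) B : (#|S| <= d)%N -> closed B ->
    monovex B -> B !=set0 -> (forall x, B x -> `|x| <= rho) ->
    (forall x y i, B x -> B y -> x ord0 i != y ord0 i -> i \in S) ->
    absolute_extensor X B.
  move=> clA mA A0 bnd; apply: (main n (finset.setTfor 'I_n)) => //.
    by rewrite -[leqRHS]card_ord max_card.
  by move=> x y i; rewrite finset.in_setT.
elim: d S B => [|d ih] S B Sd clB mB B0 bnd degen; have [S0|[i0 Si0]] := set_0Vmem S.
- by apply: absolute_extensor_subsingleton => // x y i Bx By xy;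
    have := degen _ _ _ Bx By xy; rewrite S0 inE.
- by move: Sd; rewrite (cardsD1 i0) Si0.
- by apply: absolute_extensor_subsingleton => // x y i Bx By xy;
    have := degen _ _ _ Bx By xy; rewrite S0 inE.
apply: (absolute_extensor_sections i0 nX clB mB B0 bnd) => i c B' cl' m' B'0 BB' B'c.
move=> [x [y [Bx By xy]]]; have Si := degen _ _ _ Bx By xy.
apply: (ih (S :\ i)%SET) => //.
- by move: Sd; rewrite (cardsD1 i) Si.
- by move=> z /BB'/bnd.
- move=> u v j B'u B'v uv; rewrite !inE (degen u v j (BB' _ B'u) (BB' _ B'v) uv) andbT.
  by apply/eqP => ji; move: uv; rewrite ji !B'c ?eqxx.
Qed.

(** * Retraction onto an unbounded set, and the contraction *)

Lemma box_convex_ball (R : realType) (n : nat) (rho : R) :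
  0 <= rho -> box_convex [set x : 'rV[R]_n | `|x| <= rho].
Proof.
move=> rho0 x y z /(rV_norm_le _ rho0) xr /(rV_norm_le _ rho0) yr btw.
apply/(rV_norm_le _ rho0) => i; move: (xr i) (yr i).
rewrite !ler_norml => /andP[x1 x2] /andP[y1 y2].
by case: (btw i) => /andP[h1 h2]; apply/andP; split;
  [exact: le_trans h1|exact: le_trans y2|exact: le_trans h1|exact: le_trans x2].
Qed.

Lemma closed_norm_le (R : realType) (V : normedModType R) (rho : R) :
  closed [set x : V | `|x| <= rho].
Proof.
apply: (@closed_comp _ _ (fun x : V => `|x|) [set t | t <= rho]) => [x _|].
  exact: norm_continuous.
exact: closed_le.
Qed.

Theorem closed_monovex_retract (R : realType) (n : nat) (A : set 'rV[R]_n) :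
  A !=set0 -> closed A -> monovex A ->
  exists r : 'rV[R]_n -> 'rV[R]_n,
    [/\ continuous r, (forall x, A (r x)) & forall x, A x -> r x = x].
Proof.
move=> [x0 Ax0] clA mA.
(* Starting at the norm of [x0] makes every truncation of [A] nonempty. *)
pose rho k : R := `|x0| + k%:R.
have rho0 k : 0 <= rho k by rewrite addr_ge0.
have rhoS k m : rho k <= rho (k + m)%N by rewrite lerD2l ler_nat leq_addr.
pose B k := [set x : 'rV[R]_n | `|x| <= rho k].
have clB k : closed (B k) by exact: closed_norm_le.
have clAB k : closed (A `&` B k) by exact: closedI.
have ext k : absolute_extensor 'rV[R]_n (A `&` B k).
  apply: (@absolute_extensor_compact_monovex _ _ _ _ (rho k)) => //.
  - exact: pseudometric_normal.
  - by apply: monovexI => //; exact: box_convex_ball.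
  - by exists x0; split => //; rewrite /B /= lerDl.
  - by move=> x [].
pose good k (r : 'rV[R]_n -> 'rV[R]_n) := [/\ continuous r,
  (forall x, (A `&` B k) (r x)) & forall x, (A `&` B k) x -> r x = x].
have [r0 good0] : exists r, good 0%N r.
  have [||r [? ? ?]] := ext 0%N _ id (clAB 0%N).
  - by apply: continuous_subspaceT => x; exact: cvg_id.
  - by [].
  - by exists r.
have /choice[next nextP] (kr : nat * ('rV[R]_n -> 'rV[R]_n)) :
    exists r, good kr.1 kr.2 ->
      good kr.1.+1 r /\ forall x, B kr.1 x -> r x = kr.2 x.
  case: kr => k r /=; have [[cr rA rid]|ng] := pselect (good k r); last by exists id.
  pose f x := if `|x| <= rho k then r x else x.
  have fB x : B k x -> f x = r x by rewrite /f /B /= => ->.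
  have fA x : A x -> f x = x by rewrite /f; case: ifP => // xk Ax; exact: rid.
  (* Prescribing the old [r] on the whole ball [B k], not only on [A], makes the successive
     retractions agree there. *)
  have [|||r' [cr' r'f r'A]] := ext k.+1 (B k `|` (A `&` B k.+1)) f.
  - exact: closedU.
  - apply: withinU_continuous => //.
      by apply: (@within_eq_continuous _ _ _ r) => [x /fB//|]; exact: continuous_subspaceT.
    apply: (@within_eq_continuous _ _ _ id) => [x [/fA]//|].
    by apply: continuous_subspaceT => x; exact: cvg_id.
  - move=> x [Bx|[Ax Bx]]; last by rewrite fA.
    rewrite fB //; have [? rB] := rA x; split => //.
    by apply: le_trans rB _; rewrite -addn1.
  - exists r' => _; split; last by move=> x Bx; rewrite r'f ?fB //; left.
    by split => // x ABx; rewrite r'f; [apply: fA; case: ABx|right].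
pose rs := fix rs k := if k is k'.+1 then next (k', rs k') else r0.
have rsg k : good k (rs k).
  by elim: k => //= k /(nextP (k, rs k))[].
have rsS k m x : B k x -> rs (m + k)%N x = rs k x.
  move=> Bx; elim: m => //= m <-.
  have [_ ->//] := nextP ((m + k)%N, rs (m + k)%N) (rsg _).
  by rewrite /B /= addnC (le_trans Bx).
have /choice[idx idxP] (x : 'rV[R]_n) : exists k, B k x.
  exists (Num.bound `|x|); rewrite /B /= /rho.
  by rewrite (le_trans (ltW (archi_boundP (normr_ge0 x)))) // lerDr.
pose r x := rs (idx x) x.
have rE k x : B k x -> r x = rs k x.
  by move=> Bx; rewrite /r -(rsS _ k _ (idxP x)) addnC rsS.
exists r; split.
(* One radius further, x is interior to the ball, so [r] coincides with [rs k] near x. *)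
- move=> x; set k := (idx x).+1.
  have xk : `|x| < rho k.
    by rewrite (le_lt_trans (idxP x)) // ltrD2l ltr_nat.
  have near_r : {near x, rs k =1 r}.
    have : \forall y \near x, `|y| < rho k.
      exact: (@norm_continuous R _ x _ (lt_nbhsl xk)).
    by apply: filterS => y yk; rewrite (rE k) //; exact: ltW.
  rewrite /continuous_at (rE k x); last exact: ltW.
  by apply: cvg_trans (near_eq_cvg near_r) _; have [+ _ _] := rsg k; apply.
- by move=> x; have [_ /(_ x)[]] := rsg (idx x).
- by move=> x Ax; have [_ _] := rsg (idx x); apply; split => //; exact: idxP.
Qed.
Unset Implicit Arguments.

Theorem theorem2 (R : realType) (n : nat) (A : set 'rV[R]_n) :
  A !=set0 -> closed A -> monovex A -> contractible A.
Proof.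
move=> A0 clA mA; have [r [cr rA rid]] := closed_monovex_retract A0 clA mA.
case: A0 => x0 Ax0.
(* The segment from x to [x0] may leave [A]; [r] brings it back and fixes both ends. *)
exists x0, (fun p => r ((1 - p.1) *: p.2 + p.1 *: x0)); split => //.
- apply: continuous_subspaceT => p.
  apply: (@continuous_comp _ _ _ (fun p : R * 'rV[R]_n => (1 - p.1) *: p.2 + p.1 *: x0) r);
    last exact: cr.
  apply: cvgD; apply: cvgZ; [|exact: cvg_snd|exact: cvg_fst|exact: cvg_cst].
  by apply: cvgB; [exact: cvg_cst|exact: cvg_fst].
- by move=> x Ax /=; rewrite subr0 scale1r scale0r addr0 rid.
- by move=> x Ax /=; rewrite subrr scale0r scale1r add0r rid.
Qed.
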